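(* Let $J\subset\mathbb R$ be an interval, let $\alpha_1,\dots,\alpha_m\colon J\to\mathbb R$ be continuous functions linearly independent on $J$, let $A_1,\dots,A_m$ be pairwise commuting real constant $n\times n$ matrices, and let $B_j=A_j^{T}$. Let $s\leq(m+1)/2$. Suppose $\nu^{k}=\overset{*}{\nu}{}^{k}+\widetilde\nu{}^{k} i$ ($\overset{*}{\nu}{}^{k}=\mathrm{Re}\,\nu^{k}$, $\widetilde\nu{}^{k}=\mathrm{Im}\,\nu^{k}$), $k=1,\dots,s$, are complex (this set containing no complex conjugate vectors) and $\nu^{\theta}$, $\theta=s+1,\dots,m+1-s$, are real, and that all these vectors are linearly independent common eigenvectors of the matrices $B_j$, $j=1,\dots,m$. Let $\lambda^{j}_k=\overset{*}{\lambda}{}^{j}_k+\widetilde\lambda{}^{j}_k i$ ($\overset{*}{\lambda}{}^{j}_k=\mathrm{Re}\,\lambda^{j}_k$, $\widetilde\lambda{}^{j}_k=\mathrm{Im}\,\lambda^{j}_k$) and $\lambda^{j}_\theta$ be the eigenvalues of $B_j$ corresponding to the eigenvectors $\nu^{k}$ and $\nu^{\theta}$, respectively. Let the real numbers $\overset{*}{h}_k,\widetilde h_k$ ($k=1,\dots,s$) and $h_\theta$ ($\theta=s+1,\dots,m+1-s$) be a nontrivial solution of the system $$2\sum_{k=1}^{s}\bigl(\overset{*}{\lambda}{}^{j}_k\,\overset{*}{h}_k-\widetilde\lambda{}^{j}_k\,\widetilde h_k\bigr)+\sum_{\theta=s+1}^{m+1-s}\lambda^{j}_\theta\,h_\theta=0,\quad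 j=1,\dots,m.$$ Put $P_k(x)=(\overset{*}{\nu}{}^{k}x)^2+(\widetilde\nu{}^{k}x)^2$ and $\varphi_k(x)=\arctan\dfrac{\widetilde\nu{}^{k}x}{\overset{*}{\nu}{}^{k}x}$, $k=1,\dots,s$. Then the (Lappo-Danilevskii) system $\dfrac{dx}{dt}=\sum_{j=1}^{m}\alpha_j(t)A_jx$ has the autonomous first integral $$F\colon x\mapsto\prod_{k=1}^{s}\bigl(P_k(x)\bigr)^{\overset{*}{h}_k}\exp\bigl(-2\widetilde h_k\varphi_k(x)\bigr)\prod_{\theta=s+1}^{m+1-s}|\nu^{\theta}x|^{h_\theta}\quad\text{for all }x\in\mathscr X,$$ where $\mathscr X\subset\mathbb R^n$ is any domain on which the functions $\varphi_k$ and $F$ are defined and $F$ is continuously differentiable.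
   Context: A domain is an open arcwise connected set. For a vector $\nu=(\nu_1,\dots,\nu_n)$ and $x\in\mathbb R^n$, $\nu x=\sum_{\xi=1}^n\nu_\xi x_\xi$; vectors are regarded as columns when multiplied by $B_j$. An autonomous first integral on $\mathscr X$ of $dx/dt=\sum_j\alpha_j(t)A_jx$ is a continuously differentiable function $F\colon\mathscr X\to\mathbb R$ with $\sum_{j=1}^m\alpha_j(t)\sum_{\xi=1}^n(A_jx)_\xi\,\partial_{x_\xi}F(x)=0$ for all $(t,x)\in J\times\mathscr X$. *)

(* Defs.v *)
From HB Require Import structures.
From mathcomp Require Import all_boot all_order all_algebra.
From mathcomp Require Import all_classical all_reals all_analysis.
From mathcomp Require Import complex.
Set Implicit Arguments.
Unset Strict Implicit.
Unset Printing Implicit Defensive.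
Import Order.TTheory GRing.Theory Num.Theory.
Import numFieldNormedType.Exports.
Local Open Scope classical_set_scope.
Local Open Scope ring_scope.

Definition lin_indep_on (R : realType) (m : nat) (J : set R)
    (alpha : 'I_m -> R -> R) : Prop :=
  forall c : 'I_m -> R,
    (forall t, J t -> \sum_(j < m) c j * alpha j t = 0) ->
    forall j, c j = 0.

Definition arcwise_connected (R : realType) (n : nat)
    (X : set 'cV[R]_n) : Prop :=
  forall x y, X x -> X y ->
    exists g : R -> 'cV[R]_n,
      [/\ {within `[0, 1]%classic, continuous g}, g 0 = x, g 1 = y
        & forall t, 0 <= t <= 1 -> X (g t)].

Definition domain (R : realType) (n : nat) (X : set 'cV[R]_n) : Prop :=
  open X /\ arcwise_connected X.

Definition partial (R : realType) (n : nat) (xi : 'I_n)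
    (F : 'cV[R]_n -> R) (x : 'cV[R]_n) : R :=
  'D_(delta_mx xi 0) F x.

(* Meant for open X, the only sets it is used on: differentiability and
   continuity are those of the ambient space. *)
Definition C1_on (R : realType) (n : nat) (X : set 'cV[R]_n)
    (F : 'cV[R]_n -> R) : Prop :=
  (forall x, X x -> differentiable F x) /\
  (forall xi x, X x -> {for x, continuous (partial xi F)}).

(* A function on X is represented by a total function, whose values outside
   the open set X are irrelevant. *)
Definition autonomous_first_integral (R : realType) (m n : nat) (J : set R)
    (alpha : 'I_m -> R -> R) (A : 'I_m -> 'M[R]_n)
    (X : set 'cV[R]_n) (F : 'cV[R]_n -> R) : Prop :=
  C1_on X F /\
  forall t x, J t -> X x ->
    \sum_(j < m) alpha j t *
      \sum_(xi < n) (A j *m x) xi 0 * partial xi F x = 0.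

Definition dotv (R : realType) (n : nat) (nu x : 'cV[R]_n) : R :=
  \sum_(xi < n) nu xi 0 * x xi 0.

Definition re_vec (R : realType) (n : nat) (nu : 'cV[R[i]]_n) : 'cV[R]_n :=
  map_mx (@complex.Re R) nu.
Definition im_vec (R : realType) (n : nat) (nu : 'cV[R[i]]_n) : 'cV[R]_n :=
  map_mx (@complex.Im R) nu.
Definition conj_vec (R : realType) (n : nat) (nu : 'cV[R[i]]_n) :
    'cV[R[i]]_n :=
  map_mx (@conjc R) nu.
Definition complexify (R : realType) (p q : nat) (M : 'M[R]_(p, q)) :
    'M[R[i]]_(p, q) :=
  map_mx (real_complex R) M.

Definition is_eigenvector (K : fieldType) (n : nat) (B : 'M[K]_n) (a : K)
    (v : 'cV[K]_n) : Prop :=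
  v <> 0 /\ B *m v = a *: v.

Definition Pfun (R : realType) (n : nat) (nu : 'cV[R[i]]_n)
    (x : 'cV[R]_n) : R :=
  dotv (re_vec nu) x ^+ 2 + dotv (im_vec nu) x ^+ 2.

Definition phifun (R : realType) (n : nat) (nu : 'cV[R[i]]_n)
    (x : 'cV[R]_n) : R :=
  atan (dotv (im_vec nu) x / dotv (re_vec nu) x).

(* Division and real powers are total in the library, so the natural domains
   of the formulas have to be spelled out. *)
Definition phi_defined (R : realType) (n : nat) (nu : 'cV[R[i]]_n)
    (x : 'cV[R]_n) : Prop :=
  dotv (re_vec nu) x <> 0.

(* With the convention 0 `^ 0 = 1 of powR. *)
Definition powR_defined (R : realType) (a r : R) : Prop :=
  0 < a \/ (a = 0 /\ 0 <= r).

Definition Ffun (R : realType) (n s q : nat)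
    (nuC : 'I_s -> 'cV[R[i]]_n) (nuR : 'I_q -> 'cV[R]_n)
    (hre him : 'I_s -> R) (h : 'I_q -> R) (x : 'cV[R]_n) : R :=
  (\prod_(k < s) (Pfun (nuC k) x `^ hre k *
                  expR (- 2 * him k * phifun (nuC k) x))) *
  \prod_(th < q) `|dotv (nuR th) x| `^ h th.

Definition F_defined (R : realType) (n s q : nat)
    (nuC : 'I_s -> 'cV[R[i]]_n) (nuR : 'I_q -> 'cV[R]_n)
    (hre him : 'I_s -> R) (h : 'I_q -> R) (x : 'cV[R]_n) : Prop :=
  [/\ forall k, phi_defined (nuC k) x,
      forall k, powR_defined (Pfun (nuC k) x) (hre k)
    & forall th, powR_defined `|dotv (nuR th) x| (h th)].

(* Main.v *)
(** Along the line u |-> x + u A_j x every factor g of F has a logarithmic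
    derivative at u = 0 that does not depend on x, because nu (A_j x) =
    lambda (nu x) for an eigenvector nu of A_j^T: it is 2 h* Re lambda for a
    power of P_k, - 2 h~ Im lambda for an exponential and h lambda for a real
    factor. Their sum is the left-hand side of the linear system on h, so F has
    zero derivative in the direction A_j x for each j. Writing logarithmic
    derivatives as g' = c g also covers the points where a real factor
    vanishes. *)
Require Import Defs.
From HB Require Import structures.
From mathcomp Require Import all_boot all_order all_algebra.
From mathcomp Require Import all_classical all_reals all_analysis.
From mathcomp Require Import complex.
From mathcomp Require Import ring.
Import Order.TTheory GRing.Theory Num.Theory.
Import numFieldNormedType.Exports.
Local Open Scope classical_set_scope.
Local Open Scope ring_scope.

Set Implicit Arguments.
Unset Strict Implicit.

(** * Directional derivatives as one-variable derivatives *)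

(** The differential is linear in the direction, and [v] is a combination of the basis vectors
    [delta_mx xi 0]. *)
Lemma sum_partialE (R : realType) (n : nat) (F : 'cV[R]_n -> R)
    (x v : 'cV[R]_n) :
  differentiable F x ->
  \sum_(xi < n) v xi 0 * partial xi F x = 'D_v F x.
Proof.
move=> dF; rewrite deriveE// [in RHS](matrix_sum_delta v) linear_sum.
apply: eq_bigr => i _; rewrite big_ord1 linearZ /=.
by rewrite /partial deriveE.
Qed.

Lemma derive_line (R : realType) (n : nat) (F : 'cV[R]_n -> R)
    (x v : 'cV[R]_n) :
  'D_v F x = 'D_1 (fun u : R => F (u *: v + x)) 0.
Proof.
rewrite /derive; set f := (X in X @ _); set g := (X in _ = lim (X @ _)).
suff -> : f = g by [].
by apply/funext => u; rewrite /f /g /= scale0r add0r addr0 [u *: 1]mulr1.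
Qed.

(** * Calculus of logarithmic derivatives *)

Lemma is_derive_affine (R : realType) (a l u : R) :
  is_derive u 1 (fun u : R => a + u * l) l.
Proof.
have -> : (fun u : R => a + u * l) = cst a + l \*: (@id R).
  by apply/funext => z; rewrite /= /cst mulrC.
have : is_derive u 1 (cst a + l \*: (@id R)) (0 + l *: 1) by exact: is_deriveD.
by rewrite add0r [_ *: _]mulr1.
Qed.

Lemma is_deriveM_log (R : realType) (f g : R -> R) (c d x : R) :
  is_derive x 1 f (c * f x) -> is_derive x 1 g (d * g x) ->
  is_derive x 1 (fun u => f u * g u) ((c + d) * (f x * g x)).
Proof.
move=> df dg; apply: is_derive_eq (is_deriveM df dg) _.
by rewrite /GRing.scale /=; ring.
Qed.

Lemma is_derive_prod_log (R : realType) (I : Type) (r : seq I)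
    (g : I -> R -> R) (c : I -> R) (x : R) :
  (forall i, is_derive x 1 (g i) (c i * g i x)) ->
  is_derive x 1 (fun u => \prod_(i <- r) g i u)
    ((\sum_(i <- r) c i) * \prod_(i <- r) g i x).
Proof.
move=> dg; elim: r => [|i r IH].
  rewrite [X in X * _]big_nil mul0r.
  under eq_fun do rewrite big_nil.
  exact: is_derive_cst.
under eq_fun do rewrite big_cons.
rewrite [X in X * _]big_cons [X in _ * X]big_cons.
exact: is_deriveM_log.
Qed.

Lemma is_derive_inv (R : realType) (f : R -> R) (x df : R) :
  f x != 0 -> is_derive x 1 f df ->
  is_derive x 1 (fun u => (f u)^-1) (- (f x) ^- 2 * df).
Proof.
move=> fx0 [dfx <-]; apply: DeriveDef; first exact: derivableV.
exact: deriveV.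
Qed.

Lemma is_derive_powR_log (R : realType) (f : R -> R) (c h x : R) :
  0 < f x -> is_derive x 1 f (c * f x) ->
  is_derive x 1 (fun u => f u `^ h) (h * c * f x `^ h).
Proof.
move=> fx0 df.
apply: is_derive_eq (is_derive1_comp (is_derive1_powR h fx0) df) _.
(* The chain rule yields the exponent [h - 1]; the missing factor [f x] comes from the derivative
   [c * f x] of [f]. *)
have -> : f x `^ h = f x * f x `^ (h - 1).
  rewrite -{2}(powRr1 (ltW fx0)) -powRD ?(gt_eqF fx0) ?implybT//.
  by rewrite addrC subrK.
by ring.
Qed.

Lemma near_gt0 (R : realType) (f : R -> R) (d x : R) :
  0 < f x -> is_derive x 1 f d -> \near x, 0 < f x.
Proof.
move=> fx0 [df _].
have cf : {for x, continuous f}.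
  by apply: differentiable_continuous; exact/derivable1_diffP.
exact: cf _ (lt_nbhsr fx0).
Qed.

(** With z = a + i b and l = l1 + i l2, the two derivative hypotheses say z' = l z at [x]. Hence arg
    z, which is [atan (b / a)] up to a locally constant term, has derivative Im l = [l2]. *)
Lemma is_derive_expR_atan_div (R : realType) (a b : R -> R) (l1 l2 h x : R) :
  a x != 0 ->
  is_derive x 1 a (l1 * a x - l2 * b x) ->
  is_derive x 1 b (l1 * b x + l2 * a x) ->
  is_derive x 1 (fun u => expR (h * atan (b u / a u)))
    (h * l2 * expR (h * atan (b x / a x))).
Proof.
move=> a0 da db.
have p0 : 0 < a x ^+ 2 + b x ^+ 2.
  by rewrite ltr_wpDr ?sqr_ge0// exprn_even_gt0.
have dr : is_derive x 1 (fun u => b u / a u)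
    (b x * (- a x ^- 2 * (l1 * a x - l2 * b x)) +
     (a x)^-1 * (l1 * b x + l2 * a x)).
  exact: is_deriveM db (is_derive_inv a0 da).
have dat : is_derive x 1 (fun u => atan (b u / a u)) l2.
  apply: is_derive_eq (is_derive1_comp (is_derive1_atan _) dr) _.
  (* The quotient has derivative l2 (a^2 + b^2) / a^2, and the derivative of [atan] contributes the
     inverse factor a^2 / (a^2 + b^2). *)
  by field; rewrite a0 /= gt_eqF.
have dl : is_derive x 1 (fun u => h * atan (b u / a u)) (h * l2).
  exact: is_deriveZ.
apply: is_derive_eq (is_derive1_comp (is_derive_expR _) dl) _.
by rewrite mulrC.
Qed.

(** Again z' = l z at [x], so |z|^2 has logarithmic derivative 2 Re l = [2 * l1]. *)
Lemma is_derive_sum_sqr_powR (R : realType) (a b : R -> R) (l1 l2 h x : R) :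
  a x != 0 ->
  is_derive x 1 a (l1 * a x - l2 * b x) ->
  is_derive x 1 b (l1 * b x + l2 * a x) ->
  is_derive x 1 (fun u => (a u ^+ 2 + b u ^+ 2) `^ h)
    (h * (2 * l1) * (a x ^+ 2 + b x ^+ 2) `^ h).
Proof.
move=> a0 da db.
apply: (@is_derive_powR_log _ (fun u => a u ^+ 2 + b u ^+ 2)).
  by rewrite ltr_wpDr ?sqr_ge0// exprn_even_gt0.
apply: is_derive_eq (is_deriveD (is_deriveM da da) (is_deriveM db db)) _.
by rewrite /GRing.scale /=; ring.
Qed.

(** * Linear forms, and real and imaginary parts of eigenvectors *)

Lemma dotvD (R : realType) (n : nat) (nu x y : 'cV[R]_n) :
  dotv nu (x + y) = dotv nu x + dotv nu y.
Proof.
by rewrite /dotv -big_split; apply: eq_bigr => i _; rewrite mxE mulrDr.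
Qed.

Lemma dotvZr (R : realType) (n : nat) (nu x : 'cV[R]_n) (u : R) :
  dotv nu (u *: x) = u * dotv nu x.
Proof.
by rewrite /dotv mulr_sumr; apply: eq_bigr => i _; rewrite mxE mulrCA.
Qed.

Lemma dotvZl (R : realType) (n : nat) (nu x : 'cV[R]_n) (u : R) :
  dotv (u *: nu) x = u * dotv nu x.
Proof.
by rewrite /dotv mulr_sumr; apply: eq_bigr => i _; rewrite mxE mulrA.
Qed.

Lemma dotvBl (R : realType) (n : nat) (nu mu x : 'cV[R]_n) :
  dotv (nu - mu) x = dotv nu x - dotv mu x.
Proof.
by rewrite /dotv -sumrB; apply: eq_bigr => i _; rewrite !mxE mulrBl.
Qed.

Lemma dotvDl (R : realType) (n : nat) (nu mu x : 'cV[R]_n) :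
  dotv (nu + mu) x = dotv nu x + dotv mu x.
Proof.
by rewrite /dotv -big_split; apply: eq_bigr => i _; rewrite !mxE mulrDl.
Qed.

Lemma dotv_mulmx (R : realType) (n : nat) (A : 'M[R]_n) (nu x : 'cV[R]_n) :
  dotv nu (A *m x) = dotv (A^T *m nu) x.
Proof.
have dotvE (mu y : 'cV[R]_n) : dotv mu y = (mu^T *m y) 0 0.
  by rewrite mxE; apply: eq_bigr => i _; rewrite mxE.
by rewrite !dotvE trmx_mul trmxK mulmxA.
Qed.

Lemma is_derive_dotv_line (R : realType) (n : nat) (nu v x : 'cV[R]_n) :
  is_derive (0 : R) 1 (fun u => dotv nu (u *: v + x)) (dotv nu v).
Proof.
under eq_fun do rewrite dotvD dotvZr addrC.
exact: is_derive_affine.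
Qed.

(** A real matrix acts separately on real and imaginary parts. With [re_vecZ] and [im_vecZ] this
    splits a complex eigenvector equation into two real ones. *)
Lemma re_vec_mul (R : realType) (n : nat) (B : 'M[R]_n) (v : 'cV[R[i]]_n) :
  re_vec (complexify B *m v) = B *m re_vec v.
Proof.
apply/matrixP => i j; rewrite !mxE raddf_sum.
apply: eq_bigr => k _; rewrite !mxE; case: (v k j) => a b /=.
by rewrite mul0r subr0.
Qed.

Lemma im_vec_mul (R : realType) (n : nat) (B : 'M[R]_n) (v : 'cV[R[i]]_n) :
  im_vec (complexify B *m v) = B *m im_vec v.
Proof.
apply/matrixP => i j; rewrite !mxE raddf_sum.
apply: eq_bigr => k _; rewrite !mxE; case: (v k j) => a b /=.
by rewrite mul0r addr0.
Qed.

Lemma re_vecZ (R : realType) (n : nat) (c : R[i]) (v : 'cV[R[i]]_n) :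
  re_vec (c *: v) = complex.Re c *: re_vec v - complex.Im c *: im_vec v.
Proof.
by apply/matrixP => i j; rewrite !mxE; case: c => a b; case: (v i j).
Qed.

Lemma im_vecZ (R : realType) (n : nat) (c : R[i]) (v : 'cV[R[i]]_n) :
  im_vec (c *: v) = complex.Re c *: im_vec v + complex.Im c *: re_vec v.
Proof.
by apply/matrixP => i j; rewrite !mxE; case: c => a b; case: (v i j).
Qed.

(** * The factors of F along a line *)

Lemma is_derive_complex_factor (R : realType) (n : nat) (A : 'M[R]_n)
    (nu : 'cV[R[i]]_n) (l : R[i]) (h1 h2 : R) (x : 'cV[R]_n) :
  is_eigenvector (complexify A^T) l nu -> phi_defined nu x ->
  (* Unqualified, [Pfun] is a notation of mathcomp-classical. *)
  let g u := Defs.Pfun nu (u *: (A *m x) + x) `^ h1 *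
    expR (- 2 * h2 * phifun nu (u *: (A *m x) + x)) in
  is_derive (0 : R) 1 g
    (2 * (complex.Re l * h1 - complex.Im l * h2) * g 0).
Proof.
move=> [_ eig] /eqP a0 g.
pose a (u : R) := dotv (re_vec nu) (u *: (A *m x) + x).
pose b (u : R) := dotv (im_vec nu) (u *: (A *m x) + x).
have ax : a 0 = dotv (re_vec nu) x by rewrite /a scale0r add0r.
have bx : b 0 = dotv (im_vec nu) x by rewrite /b scale0r add0r.
(* [da] and [db] are the real and imaginary parts of z' = l z at 0, for z the value of the form [nu]
   along the line. *)
have da : is_derive (0 : R) 1 a (complex.Re l * a 0 - complex.Im l * b 0).
  rewrite ax bx -!dotvZl -dotvBl -re_vecZ -eig re_vec_mul -dotv_mulmx.
  exact: is_derive_dotv_line.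
have db : is_derive (0 : R) 1 b (complex.Re l * b 0 + complex.Im l * a 0).
  rewrite ax bx -!dotvZl -dotvDl -im_vecZ -eig im_vec_mul -dotv_mulmx.
  exact: is_derive_dotv_line.
have a00 : a 0 != 0 by rewrite ax.
have dP := is_derive_sum_sqr_powR h1 a00 da db.
have dE := is_derive_expR_atan_div (- 2 * h2) a00 da db.
apply: is_derive_eq (is_deriveM_log dP dE) _.
by congr (_ * _); ring.
Qed.

(** On the line the form [nu] equals [1 + u * l] times its value at [x]. The power of that value is
    a constant factor, possibly zero, and what remains to differentiate has base 1 at [u = 0]. *)
Lemma is_derive_real_factor (R : realType) (n : nat) (A : 'M[R]_n)
    (nu : 'cV[R]_n) (l h : R) (x : 'cV[R]_n) :
  is_eigenvector A^T l nu ->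
  let g u := `|dotv nu (u *: (A *m x) + x)| `^ h in
  is_derive (0 : R) 1 g (l * h * g 0).
Proof.
move=> [_ eig] g.
have gE u : g u = `|dotv nu x| `^ h * `|1 + u * l| `^ h.
  rewrite -powRM// -normrM /g dotvD dotvZr dotv_mulmx eig dotvZl.
  by congr (`| _ | `^ _); ring.
rewrite (funext gE) mul0r addr0 normr1 powR1 mulr1.
rewrite [X in is_derive _ _ _ X]mulrC.
apply: is_deriveZ.
have q0 : 1 + 0 * l = 1 :> R by rewrite mul0r addr0.
have q_gt0 : 0 < 1 + 0 * l by rewrite q0.
have dq := is_derive_affine 1 l (0 : R).
have : is_derive (0 : R) 1 (fun u => (1 + u * l) `^ h) (l * h).
  have dq' : is_derive (0 : R) 1 (fun u => 1 + u * l) (l * (1 + 0 * l)).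
    by rewrite q0 mulr1.
  have := @is_derive_powR_log _ (fun u => 1 + u * l) l h 0 q_gt0 dq'.
  by rewrite q0 powR1 mulr1 [h * l]mulrC.
apply: near_eq_is_derive; near=> u.
by rewrite gtr0_norm//; near: u; apply: near_gt0 dq.
Unshelve. all: by end_near.
Qed.

Unset Implicit Arguments.
Set Strict Implicit.

(* The real eigenvectors, indexed by s+1, ..., m+1-s in the usual numbering,
   are m+1-2s in number. *)
Theorem theorem2p9 (R : realType) (m n s : nat)
  (J : set R) (hJ : is_interval J)
  (alpha : 'I_m -> R -> R)
  (alpha_cont : forall j, {within J, continuous (alpha j)})
  (alpha_indep : lin_indep_on J alpha)
  (A : 'I_m -> 'M[R]_n)
  (A_comm : forall i j, A i *m A j = A j *m A i)
  (hs : (s.*2 <= m.+1)%N)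
  (nuC : 'I_s -> 'cV[R[i]]_n)
  (nuR : 'I_(m.+1 - s.*2) -> 'cV[R]_n)
  (nuC_nonreal : forall k, im_vec (nuC k) <> 0)
  (nuC_nonconj : forall k l, nuC k <> conj_vec (nuC l))
  (nu_free : free ([seq nuC k | k : 'I_s] ++
                   [seq complexify (nuR th) | th : 'I_(m.+1 - s.*2)]))
  (lamC : 'I_m -> 'I_s -> R[i])
  (lamR : 'I_m -> 'I_(m.+1 - s.*2) -> R)
  (nuC_eigen : forall j k,
    is_eigenvector (complexify (A j)^T) (lamC j k) (nuC k))
  (nuR_eigen : forall j th, is_eigenvector (A j)^T (lamR j th) (nuR th))
  (hre him : 'I_s -> R) (h : 'I_(m.+1 - s.*2) -> R)
  (h_nontrivial :
    ~ [/\ forall k, hre k = 0, forall k, him k = 0 & forall th, h th = 0])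
  (h_system : forall j,
    2 * (\sum_(k < s) (complex.Re (lamC j k) * hre k -
                       complex.Im (lamC j k) * him k)) +
    \sum_(th < m.+1 - s.*2) lamR j th * h th = 0)
  (X : set 'cV[R]_n) (hX : domain X)
  (F_def : forall x, X x -> F_defined nuC nuR hre him h x)
  (F_C1 : C1_on X (Ffun nuC nuR hre him h)) :
  autonomous_first_integral J alpha A X (Ffun nuC nuR hre him h).
Proof.
split=> // t x _ Xx; rewrite big1// => j _.
rewrite sum_partialE; last exact: F_C1.1.
rewrite (_ : 'D_ _ _ _ = 0) ?mulr0//.
have [phi_def _ _] := F_def x Xx.
have dC k := is_derive_complex_factor (hre k) (him k)
  (nuC_eigen j k) (phi_def k).
have dR th := is_derive_real_factor (h th) x (nuR_eigen j th).
have := is_deriveM_log (is_derive_prod_log (index_enum _) dC)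
  (is_derive_prod_log (index_enum _) dR).
(* The coefficients of all factors add up to the left-hand side of equation [j] of [h_system], so
   the derivative of their product is 0 times that product. *)
rewrite -mulr_sumr h_system mul0r derive_line.
by case.
Qed.
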